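(* For $m,n\in\mathbb{Q}$ put $x_1=2(n+m)$, $x_2=-nm-n-m+3$, $x_3=nm-n-m-3$, $y_1=2(n-m)$, $y_2=nm-n+m+3$, $y_3=-nm-n+m-3$. Then $$[\pm(x_1,x_2),\pm(x_2,x_3),\pm(x_3,x_1)]=_5[\pm(y_1,y_2),\pm(y_2,y_3),\pm(y_3,y_1)]$$ is a parametric rational ideal solution of the two-dimensional Prouhet--Tarry--Escott problem (degree $5$, size $6$): for all $m,n\in\mathbb{Q}$ the two multisets of six points of $\mathbb{Q}^2$ have the same sum of $x^{k_1}y^{k_2}$ for all integers $k_1,k_2\ge0$ with $1\le k_1+k_2\le5$. Moreover it is symmetric (each side is invariant under $\mathbf v\mapsto-\mathbf v$), and each side consists of two triples of points each of whose sum is $\mathbf 0$, namely $(x_1,x_2)+(x_2,x_3)+(x_3,x_1)=(0,0)$ and $(y_1,y_2)+(y_2,y_3)+(y_3,y_1)=(0,0)$, together with their negatives.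
   Context: $\pm\mathbf v$ in a list means that both $\mathbf v$ and $-\mathbf v$ are listed. $[\mathbf a_1,\dots,\mathbf a_k]=_n[\mathbf b_1,\dots,\mathbf b_k]$ for points of $\mathbb{Q}^2$ means $\sum_i a_{i1}^{k_1}a_{i2}^{k_2}=\sum_i b_{i1}^{k_1}b_{i2}^{k_2}$ for all $k_1,k_2\ge0$ with $1\le k_1+k_2\le n$. It is a solution of the two-dimensional PTE problem of degree $n$ and size $k$ if in addition the two multisets are disjoint, and ideal if $k=n+1$. ''Parametric'' means that the equalities hold for all values of the parameters; for special parameter values (e.g. $m=0$) the two sides may fail to be disjoint. *)

(* Defs.v *)
From HB Require Import structures.
From mathcomp Require Import all_boot all_order all_algebra.

Set Implicit Arguments.
Unset Strict Implicit.
Unset Printing Implicit Defensive.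

Import Order.TTheory GRing.Theory Num.Theory.
Local Open Scope ring_scope.

(* Finite multisets of points of Q^2 are sequences, compared with [perm_eq]. *)
Notation point := (rat * rat)%type.

Definition moment (k1 k2 : nat) (s : seq point) : rat :=
  \sum_(a <- s) a.1 ^+ k1 * a.2 ^+ k2.

(* The relation [s] =_d [t]; both lists have the same number of points. *)
Definition pte_eq (d : nat) (s t : seq point) : Prop :=
  size s = size t /\
  forall k1 k2 : nat, (1 <= k1 + k2 <= d)%N -> moment k1 k2 s = moment k1 k2 t.

Definition disjoint_points (s t : seq point) : Prop :=
  forall v : point, v \in s -> v \notin t.

Definition pte_solution (d k : nat) (s t : seq point) : Prop :=
  [/\ size s = k, pte_eq d s t & disjoint_points s t].

Definition ideal_pte_solution (d : nat) (s t : seq point) : Prop :=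
  pte_solution d d.+1 s t.

(* Two-parameter families: the size and the moment equalities are required for
   all parameter values, disjointness only generically, that is, off the zero
   set of some nonzero polynomial in the two parameters. *)
Definition parametric_ideal_pte_solution (d : nat)
    (s t : rat -> rat -> seq point) : Prop :=
  (forall m n : rat, size (s m n) = d.+1 /\ pte_eq d (s m n) (t m n)) /\
  exists2 p : {poly {poly rat}}, p != 0 &
    forall m n : rat, p.[m%:P].[n] != 0 -> ideal_pte_solution d (s m n) (t m n).

Definition opp_points (s : seq point) : seq point := [seq - v | v <- s].

Definition symmetric_points (s : seq point) : Prop := perm_eq (opp_points s) s.

Definition cyclic_triple (a b c : rat) : seq point :=
  [:: (a, b); (b, c); (c, a)].

Definition pm_cyclic_triple (a b c : rat) : seq point :=
  [:: (a, b); - (a, b); (b, c); - (b, c); (c, a); - (c, a)].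

Definition x1 (m n : rat) : rat := 2 * (n + m).
Definition x2 (m n : rat) : rat := - (n * m) - n - m + 3.
Definition x3 (m n : rat) : rat := n * m - n - m - 3.

Definition y1 (m n : rat) : rat := 2 * (n - m).
Definition y2 (m n : rat) : rat := n * m - n + m + 3.
Definition y3 (m n : rat) : rat := - (n * m) - n + m - 3.

Definition x_points (m n : rat) : seq point :=
  pm_cyclic_triple (x1 m n) (x2 m n) (x3 m n).
Definition y_points (m n : rat) : seq point :=
  pm_cyclic_triple (y1 m n) (y2 m n) (y3 m n).

(* [s] is the union, as a multiset, of the triple [u] and of its negatives, and
   both triples have sum zero. *)
Definition zero_sum_triples (s u : seq point) : Prop :=
  [/\ size u = 3%N, perm_eq s (u ++ opp_points u),
      \sum_(v <- u) v = 0 & \sum_(v <- opp_points u) v = 0].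

(* Main.v *)
(** When a + b + c = 0, the six points of a side form the orbit of (a, b) under
    the cyclic group of order 6 generated by - tau, where tau (a, b) = (b, - a - b).
    A form of degree at most 5 invariant under this group is a multiple of a power
    of the quadratic form a^2 + a b + b^2, so the moments of degree at most 5 depend
    only on the value of this form, and that value is the same on both sides.
    Up to sign, the coordinates of a point and their sum recover a, b and c; a
    point common to both sides therefore forces x1^2 to be one of y1^2, y2^2, y3^2,
    and the product of the differences splits into linear factors. *)

Require Import Defs.
From HB Require Import structures.
From mathcomp Require Import all_boot all_order all_algebra.
From mathcomp Require Import ring lra.

Set Implicit Arguments.
Unset Strict Implicit.
Unset Printing Implicit Defensive.

Import Order.TTheory GRing.Theory Num.Theory.
Local Open Scope ring_scope.

(** The form is 1 at [(1, 0)], so that orbit supplies the constant factor. In odd degree both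
    moments vanish by symmetry, so the rounding in [./2] is harmless. *)
Lemma moment_pm_cyclic_triple (k1 k2 : nat) (a b c : rat) :
  (k1 + k2 <= 5)%N -> a + b + c = 0 ->
  moment k1 k2 (pm_cyclic_triple a b c) =
  moment k1 k2 (pm_cyclic_triple 1 0 (- 1)) *
    (a ^+ 2 + a * b + b ^+ 2) ^+ (k1 + k2)./2.
Proof.
move=> k_le5 sum0; have {c sum0}-> : c = - a - b by lra.
rewrite /moment /pm_cyclic_triple !big_cons !big_nil /=.
by case: k1 k2 k_le5 => [|[|[|[|[|[|k1]]]]]] [|[|[|[|[|[|k2]]]]]] // _; ring.
Qed.

Lemma pte_eq_pm_cyclic_triple (a b c a' b' c' : rat) :
    a + b + c = 0 -> a' + b' + c' = 0 ->
    a ^+ 2 + a * b + b ^+ 2 = a' ^+ 2 + a' * b' + b' ^+ 2 ->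
  pte_eq 5 (pm_cyclic_triple a b c) (pm_cyclic_triple a' b' c').
Proof.
move=> sum0 sum0' eq_form; split=> [|k1 k2 /andP[_ k_le5]]; first by [].
rewrite (moment_pm_cyclic_triple k_le5 sum0) eq_form.
by rewrite (moment_pm_cyclic_triple k_le5 sum0').
Qed.

(** A polynomial in [t] records the squares of [a], [b], [c] without their order; any single point
    of the side determines it. *)
Lemma mem_pm_cyclic_triple (a b c t : rat) (v : point) :
    a + b + c = 0 -> v \in pm_cyclic_triple a b c ->
  (t ^+ 2 - a ^+ 2) * (t ^+ 2 - b ^+ 2) * (t ^+ 2 - c ^+ 2) =
  (t ^+ 2 - v.1 ^+ 2) * (t ^+ 2 - v.2 ^+ 2) * (t ^+ 2 - (v.1 + v.2) ^+ 2).
Proof.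
move=> sum0; have {c sum0}-> : c = - a - b by lra.
by rewrite !inE => /or4P[|||/or3P[]] /eqP-> /=; ring.
Qed.

Lemma disjoint_pm_cyclic_triple (a b c a' b' c' : rat) :
    a + b + c = 0 -> a' + b' + c' = 0 ->
    (a ^+ 2 - a' ^+ 2) * (a ^+ 2 - b' ^+ 2) * (a ^+ 2 - c' ^+ 2) != 0 ->
  disjoint_points (pm_cyclic_triple a b c) (pm_cyclic_triple a' b' c').
Proof.
move=> sum0 sum0' neq0 v v_in; apply: contra neq0 => v_in'.
rewrite (mem_pm_cyclic_triple a sum0' v_in') -(mem_pm_cyclic_triple a sum0 v_in).
by rewrite subrr !mul0r.
Qed.

Lemma symmetric_pm_cyclic_triple (a b c : rat) :
  symmetric_points (pm_cyclic_triple a b c).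
Proof.
rewrite /symmetric_points /opp_points /= !opprK.
by apply/permP => P /=; ring.
Qed.

Lemma zero_sum_triples_pm_cyclic_triple (a b c : rat) :
  a + b + c = 0 ->
  zero_sum_triples (pm_cyclic_triple a b c) (cyclic_triple a b c).
Proof.
have sum_cyclic (u v w : rat) : u + v + w = 0 ->
    \sum_(z <- cyclic_triple u v w) z = 0.
  move=> sum0; rewrite !big_cons big_nil.
  by apply/eqP; rewrite xpair_eqE /=; apply/andP; split; apply/eqP; lra.
move=> sum0; split=> //; first by apply/permP => P /=; ring.
- exact: sum_cyclic.
(* The negated triple is, by computation, the cyclic triple of the negatives. *)
- by apply: (sum_cyclic (- a) (- b) (- c)); lra.
Qed.

Lemma sum_x_eq0 (m n : rat) : x1 m n + x2 m n + x3 m n = 0.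
Proof. by rewrite /x1 /x2 /x3; ring. Qed.

Lemma sum_y_eq0 (m n : rat) : y1 m n + y2 m n + y3 m n = 0.
Proof. by rewrite /y1 /y2 /y3; ring. Qed.

Definition exceptional_poly : {poly rat} :=
  'X * ('X - 1%:P) * ('X + 1%:P) * ('X - 3%:P) * ('X + 3%:P).

Lemma exceptional_poly_neq0 : exceptional_poly != 0.
Proof.
by rewrite !mulf_neq0 ?polyX_eq0 ?polyXsubC_eq0 // -size_poly_eq0 size_XaddC.
Qed.

Lemma horner_exceptional_poly (t : rat) :
  exceptional_poly.[t] = t * (t - 1) * (t + 1) * (t - 3) * (t + 3).
Proof. by rewrite !(hornerM, hornerXsubC, hornerD, hornerX, hornerC). Qed.

(** The factors are [16 * m * n], [- (n - 1) * (m - 3) * (n + 3) * (m + 1)] and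
    [- (n + 1) * (m + 3) * (n - 3) * (m - 1)]. *)
Lemma prod_sqr_diff_xy (m n : rat) :
  (x1 m n ^+ 2 - y1 m n ^+ 2) * (x1 m n ^+ 2 - y2 m n ^+ 2) *
    (x1 m n ^+ 2 - y3 m n ^+ 2) =
  16 * (exceptional_poly.[m] * exceptional_poly.[n]).
Proof.
by rewrite !horner_exceptional_poly /x1 /y1 /y2 /y3; ring.
Qed.

Theorem proposition5p12 :
  parametric_ideal_pte_solution 5 x_points y_points /\
  forall m n : rat,
    [/\ symmetric_points (x_points m n),
        symmetric_points (y_points m n),
        zero_sum_triples (x_points m n)
          (cyclic_triple (x1 m n) (x2 m n) (x3 m n)) &
        zero_sum_triples (y_points m n)
          (cyclic_triple (y1 m n) (y2 m n) (y3 m n))].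
Proof.
have pteP (m n : rat) : pte_eq 5 (x_points m n) (y_points m n).
  apply: pte_eq_pm_cyclic_triple; rewrite ?sum_x_eq0 ?sum_y_eq0 //.
  (* Both forms equal [(m ^+ 2 + 3) * (n ^+ 2 + 3)], which is even in [m]; the [y] side is the [x]
     side at [- m]. *)
  by rewrite /x1 /x2 /y1 /y2; ring.
split; last first.
  move=> m n; split; try exact: symmetric_pm_cyclic_triple.
  - exact/zero_sum_triples_pm_cyclic_triple/sum_x_eq0.
  - exact/zero_sum_triples_pm_cyclic_triple/sum_y_eq0.
split=> [m n|]; first by split.
(* The outer variable stands for [m], the inner one for [n]. *)
exists (exceptional_poly^:P * exceptional_poly%:P) => [|m n].
  by rewrite mulf_neq0 ?polyC_eq0 ?map_polyC_eq0 ?exceptional_poly_neq0.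
rewrite hornerM hornerC horner_map hornerM hornerC /= => neq0.
split=> //; apply: disjoint_pm_cyclic_triple; rewrite ?sum_x_eq0 ?sum_y_eq0 //.
by rewrite prod_sqr_diff_xy mulf_neq0.
Qed.
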